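(* Let $(A,B)$ be the matrix pair of an interconnected system with $N$ subsystems, with $A=(A_{ij})$ partitioned into blocks $A_{ij}\in\mathbb{R}^{n_i\times n_j}$ and $B=\mathrm{diag}(B_1,\ldots,B_N)$ with $B_i\in\mathbb{R}^{n_i\times m_i}$. If the system is fully actuated, i.e. each input matrix $B_i$ has full row rank for $i\in\mathcal{V}=\{1,\ldots,N\}$, then $(A,B)\in\Sigma_2$, i.e. the system is strongly decentralized stabilizable.
   Context: Setting. Let $\mathcal{G}_p(\mathcal{V},\mathcal{E}_p)$ be a directed graph (the plant graph) with nodes $\mathcal{V}=\{1,\ldots,N\}$ and edge set $\mathcal{E}_p\subseteq\mathcal{V}\times\mathcal{V}$ without self-loops; $(j,i)\in\mathcal{E}_p$ means that subsystem $j$ dynamically influences subsystem $i$. Put $\mathbb{N}_i=\{j\mid (j,i)\in\mathcal{E}_p\}$. Subsystem $i$ has state $x_i\in\mathbb{R}^{n_i}$, input $u_i\in\mathbb{R}^{m_i}$ and disturbance $d_i\in\mathbb{R}^{q_i}$, with dynamics $$\dot x_i(t)=A_{ii}x_i(t)+\sum_{j\in\mathbb{N}_i}A_{ij}x_j(t)+B_iu_i(t)+M_id_i(t),$$ where all matrices are real. The overall system is $\dot x=Ax+Bu+Md$, where $x$ stacks the $x_i$ (similarly $u,d$), $A$ has blocks $A_{ij}$ with $A_{ij}=0$ whenever $i\ne j$ and $(j,i)\notin\mathcal{E}_p$, $B=\mathrm{diag}(B_1,\ldots,B_N)$ and $M=\mathrm{diag}(M_1,\ldots,M_N)$. Strongly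 decentralized stabilizable: there exists a decentralized static feedback $u_i=-K_{ii}x_i$, $K_{ii}\in\mathbb{R}^{m_i\times n_i}$, $i\in\mathcal{V}$, i.e. $K=\mathrm{diag}(K_{11},\ldots,K_{NN})$, such that the (disturbance-free) closed-loop system $\dot x=(A-BK)x$ admits a block-diagonal Lyapunov function $V(x)=\sum_{i=1}^N x_i^{\mathsf T}P_ix_i$. That is, there are symmetric positive definite $P_i\in\mathbb{R}^{n_i\times n_i}$ such that, with $P=\mathrm{diag}(P_1,\ldots,P_N)$, $(A-BK)^{\mathsf T}P+P(A-BK)\prec 0$. $\Sigma_2$ denotes the set of pairs $(A,B)$ for which the system is strongly decentralized stabilizable. $\prec 0$ means symmetric negative definite. *)

(* Defs.v *)
From mathcomp Require Import all_boot all_order all_algebra.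
From mathcomp Require Import classical_sets reals.

Set Implicit Arguments.
Unset Strict Implicit.
Unset Printing Implicit Defensive.

Import Order.TTheory GRing.Theory Num.Theory.

Local Open Scope ring_scope.
Local Open Scope classical_set_scope.

(* Rectangular analogue of the library's [mxdiag], whose blocks are square.
   On the diagonal, where i = j, [conform_mx 0] only casts [D i] from type
   'M_(n i, m i) to type 'M_(n i, m j). *)
Definition blockdiag (R : pzRingType) (N : nat) (n m : 'I_N -> nat)
    (D : forall i, 'M[R]_(n i, m i)) : 'M[R]_(\sum_i n i, \sum_i m i) :=
  \mxblock_(i, j) (if i == j then conform_mx 0 (D i) else 0).

Lemma blockdiag_diag (R : pzRingType) (N : nat) (n m : 'I_N -> nat)
    (D : forall i, 'M[R]_(n i, m i)) (i : 'I_N) :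
  submxblock (blockdiag D) i i = D i.
Proof. by rewrite mxblockK eqxx conform_mx_id. Qed.

Lemma blockdiag_offdiag (R : pzRingType) (N : nat) (n m : 'I_N -> nat)
    (D : forall i, 'M[R]_(n i, m i)) (i j : 'I_N) :
  i != j -> submxblock (blockdiag D) i j = 0.
Proof. by rewrite mxblockK => /negbTE ->. Qed.

Lemma blockdiag_mxdiag (R : pzRingType) (N : nat) (n : 'I_N -> nat)
    (D : forall i, 'M[R]_(n i)) : blockdiag D = \mxdiag_i D i.
Proof. by []. Qed.

Definition posdefmx (R : realType) (k : nat) (P : 'M[R]_k) : Prop :=
  P \is symmetricmx /\
  forall x : 'cV[R]_k, x != 0 -> 0 < (x^T *m P *m x) 0 0.

Definition negdefmx (R : realType) (k : nat) (Q : 'M[R]_k) : Prop :=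
  Q \is symmetricmx /\
  forall x : 'cV[R]_k, x != 0 -> (x^T *m Q *m x) 0 0 < 0.

(* The N subsystems
     x_i' = A_ii x_i + \sum_(j in N_i) A_ij x_j + B_i u_i + M_i d_i,
   with x_i, u_i, d_i of dimensions [n i], [m i], [dist_dim i].  [edge j i] means that
   subsystem j influences subsystem i, i.e. that j is in N_i. *)
Record interconnected_system (R : realType) (N : nat) (n m : 'I_N -> nat) :=
  InterconnectedSystem {
    edge : rel 'I_N;
    edge_irreflexive : irreflexive edge;
    Ablock : forall i j, 'M[R]_(n i, n j);
    Ablock_edge : forall i j, i != j -> ~~ edge j i -> Ablock i j = 0;
    Bblock : forall i, 'M[R]_(n i, m i);
    dist_dim : 'I_N -> nat;
    Mblock : forall i, 'M[R]_(n i, dist_dim i)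
  }.

Section System.
Variables (R : realType) (N : nat) (n m : 'I_N -> nat).
Implicit Type S : interconnected_system R n m.

Definition sysA S : 'M[R]_(\sum_i n i) := \mxblock_(i, j) Ablock S i j.

Definition sysB S : 'M[R]_(\sum_i n i, \sum_i m i) := blockdiag (Bblock S).

Definition fully_actuated S : Prop := forall i, \rank (Bblock S i) = n i.

Definition strongly_decentralized_stabilizable S : Prop :=
  exists Kblock : forall i, 'M[R]_(m i, n i),
  exists Pblock : forall i, 'M[R]_(n i),
    let K := blockdiag Kblock in
    let P := \mxdiag_i Pblock i in
    let Acl := sysA S - sysB S *m K in
    (forall i, posdefmx (Pblock i)) /\ negdefmx (Acl^T *m P + P *m Acl).

End System.

Definition Sigma2 (R : realType) (N : nat) (n m : 'I_N -> nat) :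
    set ('M[R]_(\sum_i n i) * 'M[R]_(\sum_i n i, \sum_i m i)) :=
  [set (sysA S, sysB S) | S in @strongly_decentralized_stabilizable R N n m].

(* Main.v *)
Require Import Defs.
From mathcomp Require Import all_boot all_order all_algebra.
From mathcomp Require Import classical_sets reals.

(** Full row rank gives each [B_i] a right inverse [R_i].  The decentralized
    high-gain feedback [K_i = c R_i] therefore yields [B K = c I], that is,
    uniform damping [A - B K = A - c I], and the trivially block-diagonal
    choice [P = I] already works: the derivative of [x^T x] along the closed
    loop is [2 (x^T A x - c x^T x)].  A quadratic form is dominated by a
    multiple of the squared norm ([qform_le]), so it is enough to take [c]
    above that multiple, whatever the interconnection blocks are. *)

Set Implicit Arguments.
Unset Strict Implicit.
Unset Printing Implicit Defensive.

Import Order.TTheory GRing.Theory Num.Theory.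

Local Open Scope ring_scope.

Lemma blockdiagM (R : pzRingType) (N : nat) (n m p : 'I_N -> nat)
    (D : forall i, 'M[R]_(n i, m i)) (E : forall i, 'M[R]_(m i, p i)) :
  blockdiag D *m blockdiag E = blockdiag (fun i => D i *m E i).
Proof.
rewrite /blockdiag mul_mxblock; apply/eq_mxblockP => i k.
rewrite (bigD1 i) //= eqxx conform_mx_id big1 ?addr0.
  case: eqVneq => [<-|_]; last by rewrite mulmx0.
  by rewrite !conform_mx_id.
by move=> j /negbTE ji; rewrite eq_sym ji mul0mx.
Qed.

Section QuadraticForms.
Variables (R : realDomainType) (k : nat).
Implicit Types (A : 'M[R]_k) (x : 'cV[R]_k).

Lemma sqnormE x : (x^T *m x) 0 0 = \sum_i x i 0 ^+ 2.
Proof. by rewrite mxE; apply: eq_bigr => i _; rewrite mxE. Qed.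

Lemma sqr_entry_le x i : x i 0 ^+ 2 <= (x^T *m x) 0 0.
Proof.
rewrite sqnormE (bigD1 i) //= lerDl sumr_ge0 // => j _.
exact: sqr_ge0.
Qed.

Lemma sqnorm_gt0 x : x != 0 -> 0 < (x^T *m x) 0 0.
Proof.
move=> x0; have /cV0Pn[i xi0] := x0.
by apply: lt_le_trans (sqr_entry_le x i); rewrite exprn_even_gt0.
Qed.

(** Both factors of [x_i x_j] are at most the Euclidean norm of [x] in absolute
    value, so the entrywise l1 norm of [A] is a valid, if crude, constant;
    it spares any appeal to eigenvalues. *)
Lemma qform_le A x :
  (x^T *m A *m x) 0 0 <= (\sum_j \sum_i `|A i j|) * (x^T *m x) 0 0.
Proof.
set s := (x^T *m x) 0 0; rewrite mxE mulr_suml; apply: ler_sum => j _.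
rewrite mxE !mulr_suml; apply: ler_sum => i _; rewrite mxE.
rewrite mulrAC mulrC; apply: le_trans (ler_norm _) _.
rewrite normrM ler_wpM2l //.
have [xij|/ltW xji] := leP `|x i 0| `|x j 0|.
  apply: le_trans (sqr_entry_le x j); rewrite -real_normK ?num_real // expr2 normrM.
  by rewrite ler_wpM2r.
apply: le_trans (sqr_entry_le x i); rewrite -real_normK ?num_real // expr2 normrM.
by rewrite ler_wpM2l.
Qed.

End QuadraticForms.

Lemma posdefmx1 (R : realType) (k : nat) : posdefmx (1%:M : 'M[R]_k).
Proof.
split; first by apply/is_hermitianmxP; rewrite scale1r map_mx_id ?trmx1.
by move=> x x0; rewrite mulmx1 sqnorm_gt0.
Qed.

Lemma damped_negdef (R : realType) (k : nat) (A : 'M[R]_k) (c : R) :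
  \sum_j \sum_i `|A i j| < c ->
  negdefmx ((A - c%:M)^T + (A - c%:M)).
Proof.
move=> Ac; set F := A - c%:M; split.
  by apply/is_hermitianmxP; rewrite scale1r map_mx_id // [RHS]linearD /= trmxK addrC.
move=> x x0; rewrite mulmxDr mulmxDl.
(* A scalar is its own transpose, so both summands have the same value. *)
have -> : x^T *m F^T *m x = (x^T *m F *m x)^T.
  by rewrite !trmx_mul trmxK mulmxA.
rewrite [x^T *m F *m x]mx11_scalar tr_scalar_mx -mx11_scalar mxE.
suff F0 : (x^T *m F *m x) 0 0 < 0 by rewrite -mulr2n pmulrn_llt0.
rewrite mulmxBr mulmxBl mul_mx_scalar -scalemxAl.
rewrite mxE [X in _ + X]mxE [X in _ - X]mxE subr_lt0.
apply: le_lt_trans (qform_le A x) _.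
by rewrite ltr_pM2r // sqnorm_gt0.
Qed.

Theorem proposition1 (R : realType) (N : nat) (n m : 'I_N -> nat)
    (S : interconnected_system R n m) (hB : fully_actuated S) :
  Sigma2 (sysA S, sysB S).
Proof.
exists S => //.
pose c : R := \sum_j \sum_i `|sysA S i j| + 1.
exists (fun i => c *: pinvmx (Bblock S i)), (fun i => 1%:M) => /=.
split=> [i|]; first exact: posdefmx1.
have -> : sysB S *m blockdiag (fun i => c *: pinvmx (Bblock S i)) = c%:M.
  rewrite blockdiagM blockdiag_mxdiag -mxdiagZ.
  apply/eq_mxdiagP => i; rewrite -scalemxAr mulmxVp ?scalemx1 //.
  by rewrite /row_free hB.
rewrite mxdiagZ mulmx1 mul1mx.
by apply: damped_negdef; rewrite ltrDl.
Qed.
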